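(* Let $d\geq 2$. There exists an optimal candidate function $f^*\in\mathcal{C}_d$, i.e., one with $f^*(l)\geq f(l)$ for every $f\in\mathcal{C}_d$ and every integer $l\geq 0$; moreover its values $f^*(0),f^*(1),\ldots,f^*(d)$ can be computed in $O(d^2)$ time.
   Context: For an integer $d\geq 2$, $\mathcal{C}_d$ (the set of candidate functions) is the set of non-decreasing functions $f:\{0,1,2,\ldots\}\to\mathbb{R}$ with $f(0)=1$ such that for all integers $0\leq m\leq d-1$ and all integers $0\leq l_1\leq\cdots\leq l_m$, $$1+\frac{\sum_{i=1}^m f(l_i)}{d-m}\geq\prod_{i=1}^m\frac{f(l_i+1)}{f(l_i)}.$$ Time is measured counting arithmetic operations on reals (including taking $m$-th roots) as unit cost. *)

(* Defs.v *)
From mathcomp Require Import all_boot all_order all_algebra.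
From mathcomp Require Import all_classical all_reals all_analysis.

Set Implicit Arguments.
Unset Strict Implicit.
Unset Printing Implicit Defensive.

Import Order.TTheory GRing.Theory Num.Theory.
Local Open Scope ring_scope.

(* Membership in C_d.  The tuple l lists l_1 <= ... <= l_m. *)
Definition candidate (R : realType) (d : nat) (f : nat -> R) : Prop :=
  [/\ nondecreasing_seq f, f 0%N = 1 &
      forall (m : nat) (l : m.-tuple nat),
        (m <= d - 1)%N -> sorted leq l ->
        \prod_(i <- l) (f i.+1 / f i)
          <= 1 + (\sum_(i <- l) f i) / (d%:R - m%:R)].

Definition optimal_candidate (R : realType) (d : nat) (f : nat -> R) : Prop :=
  candidate d f /\
  forall g : nat -> R, candidate d g -> forall l : nat, g l <= f l.

(* A real RAM: unbounded memories of integer cells I[0], I[1], ... and of real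
   cells X[0], X[1], ..., a program counter and a write-only output tape of
   reals.  Every instruction, including integer operations, memory accesses
   and jumps, costs one unit of time.  There is no conversion from reals to
   integers, and the only constants are natural numbers, so no information
   can be hidden in a real constant. *)
Inductive instr : Type :=
  | IConst (i k : nat)      (* I[i] := k *)
  | IAdd   (i j k : nat)    (* I[i] := I[j] + I[k] *)
  | ISub   (i j k : nat)    (* I[i] := I[j] - I[k], truncated at 0 *)
  | ILoad  (i j : nat)      (* I[i] := I[I[j]] *)
  | IStore (i j : nat)      (* I[I[i]] := I[j] *)
  | XCast  (x i : nat)      (* X[x] := I[i] *)
  | XAdd   (x y z : nat)    (* X[x] := X[y] + X[z] *)
  | XSub   (x y z : nat)    (* X[x] := X[y] - X[z] *)
  | XMul   (x y z : nat)    (* X[x] := X[y] * X[z] *)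
  | XDiv   (x y z : nat)    (* X[x] := X[y] / X[z]; fails if X[z] = 0 *)
  | XRoot  (x i y : nat)    (* X[x] := I[i]-th root of X[y];
                               fails if I[i] = 0 or X[y] < 0 *)
  | XLoad  (x i : nat)      (* X[x] := X[I[i]] *)
  | XStore (i x : nat)      (* X[I[i]] := X[x] *)
  | Output (x : nat)        (* append X[x] to the output tape *)
  | Jump   (p : nat)        (* go to p *)
  | JumpILt (i j p : nat)   (* if I[i] < I[j], go to p *)
  | JumpXLt (x y p : nat)   (* if X[x] < X[y], go to p *)
  | Halt.

Definition program := seq instr.

Record config (R : realType) := Config {
  pc : nat;
  imem : nat -> nat;
  xmem : nat -> R;
  tape : seq R }.

(* Running off the end of the program counts as reaching Halt. *)
Definition current (R : realType) (P : program) (c : config R) : instr :=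
  nth Halt P (pc c).

(* None means that no step is possible: the machine has halted, or the
   operation is undefined. *)
Definition step (R : realType) (P : program) (c : config R)
    : option (config R) :=
  let: Config q iM xM t := c in
  let seti i (v : nat) := Some (Config q.+1 [eta iM with i |-> v] xM t) in
  let setx x (v : R) := Some (Config q.+1 iM [eta xM with x |-> v] t) in
  let jump b p := Some (Config (if b then p else q.+1) iM xM t) in
  match current P c with
  | IConst i k => seti i k
  | IAdd i j k => seti i (iM j + iM k)%N
  | ISub i j k => seti i (iM j - iM k)%N
  | ILoad i j => seti i (iM (iM j))
  | IStore i j => seti (iM i) (iM j)
  | XCast x i => setx x (iM i)%:R
  | XAdd x y z => setx x (xM y + xM z)
  | XSub x y z => setx x (xM y - xM z)
  | XMul x y z => setx x (xM y * xM z)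
  | XDiv x y z => if xM z == 0 then None else setx x (xM y / xM z)
  | XRoot x i y =>
      if (0 < iM i)%N && (0 <= xM y) then setx x (xM y `^ (iM i)%:R^-1) else None
  | XLoad x i => setx x (xM (iM i))
  | XStore i x => setx (iM i) (xM x)
  | Output x => Some (Config q.+1 iM xM (rcons t (xM x)))
  | Jump p => jump true p
  | JumpILt i j p => jump (iM i < iM j)%N p
  | JumpXLt x y p => jump (xM x < xM y) p
  | Halt => None
  end.

(* The input n is placed in I[0]; every other cell initially holds 0. *)
Definition init (R : realType) (n : nat) : config R :=
  Config 0 (fun i => if i == 0 then n else 0)%N (fun=> 0) [::].

Definition computes_within (R : realType) (P : program) (n : nat)
    (out : seq R) (T : nat) : Prop :=
  exists (t : nat) (c : config R),
    [/\ (t <= T)%N, iter t (obind (step P)) (Some (init R n)) = Some c,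
        current P c = Halt & tape c = out].

(* Main.v *)
(** By the tuples with all entries equal to l, membership in C_d forces
    f(l+1)/f(l) <= min_(1 <= m < d) (1 + m f(l)/(d-m))^(1/m).  Conversely these
    inequalities imply all the others, since the geometric mean of the numbers
    1 + m f(l_i)/(d-m) is at most their arithmetic mean.  The right-hand side is
    monotone in f(l), so taking equality at every step gives the optimal
    candidate, and each of its values costs O(d) operations. *)
Require Import Defs.
From mathcomp Require Import all_boot all_order all_algebra.
From mathcomp Require Import all_classical all_reals all_analysis.
From mathcomp Require Import zify.

Set Implicit Arguments.
Unset Strict Implicit.
Unset Printing Implicit Defensive.

Import Order.TTheory GRing.Theory Num.Theory.

(** * Upper bounds for the ratio of consecutive values *)

Section GreedyCandidate.
Local Open Scope ring_scope.
Variables (R : realType) (d : nat).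
Implicit Types (x y : R) (f : nat -> R).

Definition ratio_bound x (m : nat) : R := 1 + m%:R * x / (d%:R - m%:R).

(* The initial value 1 + x does not affect the minimum once n >= 1, because it
   is at least [ratio_bound x 1]. *)
Fixpoint min_root x (n : nat) : R :=
  if n is n'.+1 then Num.min (min_root x n') (ratio_bound x n `^ n%:R^-1)
  else 1 + x.

Definition greedy (l : nat) : R := iter l (fun x => x * min_root x d.-1) 1.

Lemma ratio_bound_ge1 x m : 0 <= x -> (m < d)%N -> 1 <= ratio_bound x m.
Proof.
move=> x0 md; rewrite lerDl divr_ge0 ?mulr_ge0 //.
by rewrite subr_ge0 ler_nat ltnW.
Qed.

Lemma ratio_bound_le x y m : (m < d)%N -> x <= y ->
  ratio_bound x m <= ratio_bound y m.
Proof.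
move=> md xy; rewrite lerD2l ler_pM2r; first exact: ler_wpM2l.
by rewrite invr_gt0 subr_gt0 ltr_nat.
Qed.

Lemma le_root x y m : (0 < m)%N -> 0 <= x -> 0 <= y ->
  (x <= y `^ m%:R^-1) = (x ^+ m <= y).
Proof.
move=> m0 x0 y0.
have mN0 : m%:R != 0 :> R by rewrite pnatr_eq0 -lt0n.
rewrite -(ler_pXn2r m0) ?nnegrE ?powR_ge0 // -[X in _ <= X]powR_mulrn ?powR_ge0 //.
by rewrite -powRrM mulVf // powRr1.
Qed.

Lemma min_root_ge1 x n : 0 <= x -> (n < d)%N -> 1 <= min_root x n.
Proof.
move=> x0; elim: n => [|n IH] nd; first by rewrite /= lerDl.
rewrite [min_root _ _]/= le_min IH ?(ltnW nd) //=.
have h1 := ratio_bound_ge1 x0 nd.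
by rewrite le_root ?expr1n // (le_trans ler01 h1).
Qed.

Lemma min_root_le x y n : 0 <= x -> x <= y -> (n < d)%N ->
  min_root x n <= min_root y n.
Proof.
move=> x0 xy; elim: n => [|n IH] nd; first by rewrite /= lerD2l.
rewrite [min_root x _]/= [min_root y _]/= le_min !ge_min IH ?(ltnW nd) //=.
have y0 := le_trans x0 xy.
rewrite ge0_ler_powR ?orbT ?nnegrE ?ratio_bound_le ?invr_ge0 //;
  exact: le_trans ler01 (ratio_bound_ge1 _ nd).
Qed.

(** Trades the minimum of roots for the root-free power inequalities in which the candidate
    condition is stated; [r <= 1 + x] records the base case of [min_root]. *)
Lemma le_min_rootP x r n : 0 <= x -> 0 <= r -> (n < d)%N ->
  reflect (r <= 1 + x /\ forall m, (0 < m <= n)%N -> r ^+ m <= ratio_bound x m)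
          (r <= min_root x n).
Proof.
move=> x0 r0; elim: n => [|n IH] nd.
  apply: (iffP idP) => [h|[]//]; split=> // m; lia.
have rb0 : 0 <= ratio_bound x n.+1 := le_trans ler01 (ratio_bound_ge1 x0 nd).
rewrite [min_root _ _]/= le_min le_root //.
apply: (iffP andP) => [[/(IH (ltnW nd))[h1 h2] h3]|[h1 h2]].
  split=> // m /andP[m0]; rewrite leq_eqVlt => /orP[/eqP -> //|mn].
  by apply: h2; rewrite m0.
split; last by apply: h2; rewrite leqnn.
apply/(IH (ltnW nd)); split=> // m /andP[m0 mn].
by apply: h2; rewrite m0 leqW.
Qed.

(** * Candidates as solutions of a one-step inequality *)

Lemma candidate_ge1 f l : nondecreasing_seq f -> f 0%N = 1 -> 1 <= f l.
Proof. by move=> fnd <-; exact: fnd. Qed.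

(** Replaces the condition on all tuples by a recurrence in [l], so that optimality becomes an
    induction. *)
Lemma candidateP f : (2 <= d)%N ->
  candidate d f <->
  [/\ nondecreasing_seq f, f 0%N = 1 &
      forall l, f l.+1 <= f l * min_root (f l) d.-1].
Proof.
move=> d2; have d0 : (0 < d)%N by lia.
have d1 : (d.-1 < d)%N by lia.
split=> -[fnd f0 H]; split=> //; have f1 k : 1 <= f k by exact: candidate_ge1.
all: have fp k : 0 < f k by exact: lt_le_trans ltr01 (f1 k).
all: have r0 k : 0 <= f k.+1 / f k by rewrite divr_ge0 ?ltW.
- move=> l; rewrite mulrC -ler_pdivrMr //.
  have key m : (0 < m <= d.-1)%N -> (f l.+1 / f l) ^+ m <= ratio_bound (f l) m.
    move=> mP; have mdN : (m <= d - 1)%N by lia.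
    have /H := mdN => /(_ (nseq_tuple m l)) /=.
    rewrite !big_nseq !iter_mulr_1 iter_addr_0 /ratio_bound mulr_natl => h; apply: h.
    by apply/(sortedP 0%N) => i; rewrite size_nseq => hi; rewrite !nth_nseq hi (ltnW hi).
  apply/le_min_rootP => //; first exact: ltW.
  (* The bound by [1 + x] follows from the case [m = 1], since [d - 1 >= 1]. *)
  split=> //; have := key 1%N; rewrite expr1 => h.
  apply: le_trans (h _) _; first by lia.
  rewrite lerD2l mul1r ler_pdivrMr ?ler_peMr ?(ltW (fp l)) //.
    by rewrite lerBrDr -[1 + 1]/(2%:R) ler_nat.
  by rewrite subr_gt0 ltr_nat.
(* The empty tuple is treated apart because the mean below divides by the length. *)
- move=> [|m] s md _; first by rewrite tuple0 !big_nil mul0r addr0.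
  have {}H k : (f k.+1 / f k) ^+ m.+1 <= ratio_bound (f k) m.+1.
    have /le_min_rootP [] : f k.+1 / f k <= min_root (f k) d.-1.
    + by rewrite ler_pdivrMr // mulrC.
    + exact: ltW.
    + exact: r0.
    + exact: d1.
    by move=> _; apply; lia.
  rewrite !big_tuple.
  set r := fun i : 'I_m.+1 => f (tnth s i).+1 / f (tnth s i).
  have P0 : 0 <= \prod_i r i by apply: prodr_ge0 => i _; exact: r0.
  (* AM-GM is applied to the powers [r i ^+ m.+1], so that both sides are [m.+1]-th powers and the
     exponent cancels. *)
  have := @leif_AGM R _ 'I_m.+1 (fun i => r i ^+ m.+1).
  move=> /(_ (fun i _ => exprn_ge0 _ (r0 _))) [AGM _].
  rewrite prodrXl card_ord ler_pXn2r ?nnegrE // in AGM; last first.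
    by rewrite divr_ge0 // sumr_ge0 // => i _; exact: exprn_ge0 (r0 _).
  apply: le_trans AGM _; rewrite ler_pdivrMr ?ltr0n //.
  apply: (le_trans (ler_sum _ (fun i _ => H (tnth s i)))).
  rewrite big_split /= sumr_const card_ord mulrDl mul1r lerD2l.
  by rewrite -mulr_suml -mulr_sumr -mulrA mulrC.
Qed.

Lemma greedy_optimal : (2 <= d)%N -> optimal_candidate d greedy.
Proof.
move=> d2; have d1 : (d.-1 < d)%N by lia.
have grS l : greedy l.+1 = greedy l * min_root (greedy l) d.-1 by [].
have gr0 l : 0 <= greedy l.
  elim: l => [|l IH]; first exact: ler01.
  by rewrite grS mulr_ge0 // (le_trans ler01) ?min_root_ge1.
split.
  apply/candidateP => //; split=> //.
  apply/nondecreasing_seqP => l.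
  by rewrite grS ler_peMr ?min_root_ge1.
(* The map sending [x] to [x * min_root x d.-1] is monotone for [x >= 0], so the induction carries
   [g l <= greedy l] to [l.+1]. *)
move=> g /(candidateP _ d2) [gnd g0 H]; elim=> [|l IH]; first by rewrite g0.
have gl0 : 0 <= g l := le_trans ler01 (candidate_ge1 l gnd g0).
apply: (le_trans (H l)); rewrite grS ler_pM ?min_root_le //.
by rewrite (le_trans ler01) ?min_root_ge1.
Qed.

(** Transfers the running time proved for [greedy] to an arbitrary optimal candidate. *)
Lemma optimal_candidate_unique f g :
  optimal_candidate d f -> optimal_candidate d g -> f =1 g.
Proof. by move=> [cf mf] [cg mg] l; apply/eqP; rewrite eq_le mf ?mg. Qed.

End GreedyCandidate.

(** * A real-RAM program for the greedy values, and its running time *)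

Section GreedyProgram.
Local Open Scope ring_scope.
Variable R : realType.

(* I[1] = 1, I[2] = l, I[3] = m and I[4] = d - m; X[0] = 1, X[1] = f(l), X[2] is
   the current minimum, X[3] and X[4] are temporaries, and X[5] = 0. *)
Definition greedy_program : program := [::
  IConst 1 1;
  XCast 0 1;
  XCast 1 1;
  Output 1;
  (* 4: loop over l *)
  JumpILt 2 0 6;
  Halt;
  IConst 3 1;
  XAdd 2 0 1;
  (* 8: loop over m *)
  JumpILt 3 0 13;
  XMul 1 1 2;
  Output 1;
  IAdd 2 2 1;
  Jump 4;
  ISub 4 0 3;
  XCast 3 3;
  XCast 4 4;
  XMul 3 3 1;
  XDiv 3 3 4;
  XAdd 3 0 3;
  XRoot 3 3 3;
  JumpXLt 2 3 22;
  XAdd 2 3 5;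
  IAdd 3 3 1;
  Jump 8].

(** A total-correctness judgement with time budget [T]; budgets add under composition. *)
Definition leads_to (P : program) (T : nat) (Q : config R -> Prop) (c : config R) :=
  exists t c', [/\ (t <= T)%N, iter t (obind (step P)) (Some c) = Some c' & Q c'].

Lemma leads_to_now P T (Q : config R -> Prop) c : Q c -> leads_to P T Q c.
Proof. by exists 0%N, c. Qed.

(** The premise is a computation, so simplification executes one instruction symbolically; a stuck
    machine yields [False]. *)
Lemma leads_to_step P T (Q : config R -> Prop) c :
  (if step P c is Some c1 then leads_to P T Q c1 else False) ->
  leads_to P T.+1 Q c.
Proof.
case E: (step P c) => [c1|//] [t [c' [tT it Qc']]].
by exists t.+1, c'; split=> //; rewrite iterSr /= E.
Qed.

Lemma leads_to_leq P T1 T2 (Q : config R -> Prop) c :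
  (T1 <= T2)%N -> leads_to P T1 Q c -> leads_to P T2 Q c.
Proof.
by move=> leT [t [c' [le1 it Qc']]]; exists t, c'; split=> //; exact: leq_trans leT.
Qed.

Lemma leads_to_trans P T1 T2 (Q1 Q2 : config R -> Prop) c :
  leads_to P T1 Q1 c -> (forall c', Q1 c' -> leads_to P T2 Q2 c') ->
  leads_to P (T1 + T2) Q2 c.
Proof.
move=> [t1 [c1 [le1 it1 /[swap]]]] /[apply] -[t2 [c2 [le2 it2 Q2c]]].
exists (t2 + t1)%N, c2; split=> //; first by lia.
by rewrite iterD it1.
Qed.

(** Invariant at the head of the loop over [l]. *)
Definition outer_state (d l : nat) (c : config R) : Prop :=
  [/\ pc c = 4, [/\ imem c 0 = d, imem c 1 = 1 & imem c 2 = l]%N,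
      [/\ xmem c 0%N = 1, xmem c 1%N = greedy R d l & xmem c 5 = 0] &
      tape c = [seq greedy R d i | i <- iota 0 l.+1]].

(** Invariant at the head of the loop over [m]: the bound of index [m] is still to be processed,
    hence [m.-1]. *)
Definition inner_state (d l m : nat) (c : config R) : Prop :=
  [/\ pc c = 8, [/\ imem c 0 = d, imem c 1 = 1, imem c 2 = l & imem c 3 = m]%N,
      [/\ xmem c 0%N = 1, xmem c 1%N = greedy R d l,
          xmem c 2%N = min_root d (greedy R d l) m.-1 & xmem c 5 = 0] &
      tape c = [seq greedy R d i | i <- iota 0 l.+1]].

Lemma greedy_ge0 d l : (2 <= d)%N -> 0 <= greedy R d l.
Proof.
move=> /(greedy_optimal R) [[gnd g0 _] _].
exact: le_trans ler01 (candidate_ge1 l gnd g0).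
Qed.

(** The longer branch, which updates the minimum, takes 12 instructions. *)
Lemma inner_body d l m c : (2 <= d)%N -> (0 < m < d)%N -> inner_state d l m c ->
  leads_to greedy_program 12 (inner_state d l m.+1) c.
Proof.
move=> d2 /andP[m0 md]; case: c => q iM xM t [/= -> [i0 i1 i2 i3] [x0 x1 x2 x5] ->].
(* [rb0] and [dm0] ensure that the root and the division do not fail. *)
have rb0 : 0 <= ratio_bound d (greedy R d l) m.
  exact: le_trans ler01 (ratio_bound_ge1 (greedy_ge0 _ d2) md).
have dm0 : ((d - m)%:R == 0 :> R) = false by rewrite pnatr_eq0; apply/eqP; lia.
have rbE : 1 + m%:R * greedy R d l / (d - m)%:R = ratio_bound d (greedy R d l) m.
  by rewrite natrB // ltnW.
have minE : min_root d (greedy R d l) m =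
    Num.min (min_root d (greedy R d l) m.-1)
            (ratio_bound d (greedy R d l) m `^ m%:R^-1).
  by case: m m0 {md rb0 dm0 rbE i3 x2}.
apply: leads_to_step; rewrite /= i0 i3 md.
do 4 apply: leads_to_step => /=.
rewrite i0 i3 x1.
apply: leads_to_step; rewrite /= dm0.
apply: leads_to_step; rewrite /= x0 rbE.
apply: leads_to_step; rewrite /= i3 m0 rb0 /=.
apply: leads_to_step => /=.
rewrite x2; case: ifPn => h.
  apply: leads_to_step; rewrite /= i1 i3.
  apply: leads_to_step; apply: leads_to_now.
  by split=> //; split; rewrite //= ?addn1 // x2 minE min_l // ltW.
apply: leads_to_step; rewrite /= x5 addr0.
apply: leads_to_step; rewrite /= i1 i3.
apply: leads_to_step; apply: leads_to_now.
by split=> //; split; rewrite //= ?addn1 // minE min_r // leNgt.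
Qed.

Lemma inner_loop d l m c : (2 <= d)%N -> (0 < m <= d)%N -> inner_state d l m c ->
  leads_to greedy_program (12 * (d - m)) (inner_state d l d) c.
Proof.
move=> d2; move Ek: (d - m)%N => k.
elim: k m c Ek => [|k IH] m c Ek mP st.
  by apply: leads_to_now; have mE : m = d; [lia|rewrite mE in st].
rewrite mulnS; apply: leads_to_trans (inner_body d2 _ st) _; first by lia.
by move=> c' st'; apply: IH st'; lia.
Qed.

Lemma outer_body d l c : (2 <= d)%N -> (l < d)%N -> outer_state d l c ->
  leads_to greedy_program (12 * d) (outer_state d l.+1) c.
Proof.
move=> d2 ld; case: c => q iM xM t [/= -> [i0 i1 i2] [x0 x1 x5] ->].
(* Three instructions lead into the inner loop, which makes [d - 1] passes; five more leave it,
   update and output the value, and jump back. *)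
apply: (@leads_to_leq _ (12 * (d - 1) + 5).+3); first by lia.
apply: leads_to_step; rewrite /= i0 i2 ld.
apply: leads_to_step; rewrite /=.
apply: leads_to_step; rewrite /= x0 x1.
apply: leads_to_trans; first by apply: (@inner_loop d l); [|lia|split].
case=> {}q {i0 i1 i2}iM {x0 x1 x5}xM {}t /=.
move=> [/= -> [i0 i1 i2 i3] [x0 x1 x2 x5] ->].
apply: leads_to_step; rewrite /= i0 i3 ltnn.
apply: leads_to_step; rewrite /= x1 x2.
apply: leads_to_step; rewrite /=.
apply: leads_to_step; rewrite /= i1 i2.
apply: leads_to_step; apply: leads_to_now.
split=> //; first by split; rewrite //= addn1.
by rewrite -[l.+2]addn1 iotaD map_cat cats1.
Qed.

Lemma outer_loop d l c : (2 <= d)%N -> (l <= d)%N -> outer_state d l c ->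
  leads_to greedy_program (12 * d * (d - l)) (outer_state d d) c.
Proof.
move=> d2; move Ek: (d - l)%N => k.
elim: k l c Ek => [|k IH] l c Ek ld st.
  by apply: leads_to_now; have lE : l = d; [lia|rewrite lE in st].
rewrite mulnS; apply: leads_to_trans (outer_body d2 _ st) _; first by lia.
by move=> c' st'; apply: IH st'; lia.
Qed.

Lemma greedy_program_computes d : (2 <= d)%N ->
  computes_within greedy_program d [seq greedy R d l | l <- iota 0 d.+1] (14 * d ^ 2).
Proof.
move=> d2.
have : leads_to greedy_program (14 * d ^ 2)
    (fun c => current greedy_program c = Halt /\
              tape c = [seq greedy R d l | l <- iota 0 d.+1]) (init R d).
  (* Four initial instructions and one final test are added to the loop; [d >= 2] absorbs these five
     steps into [2 * d ^ 2]. *)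
  apply: (@leads_to_leq _ (12 * d * (d - 0) + 1).+4); first by nia.
  do 4 apply: leads_to_step => /=.
  apply: leads_to_trans; first by apply: (@outer_loop d 0%N).
  case=> q iM xM t [/= -> [i0 i1 i2] _ ->].
  apply: leads_to_step; rewrite /= i0 i2 ltnn.
  exact: leads_to_now.
by move=> [t [c [tT it [hc tc]]]]; exists t, c.
Qed.

End GreedyProgram.

Theorem theorem4p5 (R : realType) :
  (forall d : nat, (2 <= d)%N ->
     exists fstar : nat -> R, optimal_candidate d fstar)
  /\
  (exists (P : program) (C : nat),
     forall (d : nat) (fstar : nat -> R),
       (2 <= d)%N -> optimal_candidate d fstar ->
       computes_within P d [seq fstar l | l <- iota 0 d.+1] (C * d ^ 2)%N).
Proof.
split=> [d d2|]; first by exists (greedy R d); exact: greedy_optimal.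
exists greedy_program, 14%N => d f d2 optf.
rewrite (eq_map (optimal_candidate_unique optf (greedy_optimal R d2))).
exact: greedy_program_computes.
Qed.
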